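(* There is no skew-symmetric amorphous association scheme with at least $4$ classes.
   Context: Let $X$ be a finite set with $|X|\ge 2$ and $R=\{R_0,\dots,R_d\}$ a set of binary relations on $X$. $(X,R)$ is an association scheme with $d$ classes if: (i) $R$ partitions $X\times X$ and $R_0=\{(x,x):x\in X\}$; (ii) for each $i$, the inverse $R_i^{T}=\{(y,x):(x,y)\in R_i\}$ equals $R_{i'}$ for some $i'$; (iii) for all $i,j,k$ there is an integer $p^k_{ij}$ such that for every $(x,y)\in R_k$, $|\{z:(x,z)\in R_i,(z,y)\in R_j\}|=p^k_{ij}$. $R_i$ is symmetric if $R_i^T=R_i$. The scheme is skew-symmetric if $R_0$ is its only symmetric relation. A partition $\Lambda_0,\Lambda_1,\dots,\Lambda_e$ of the index set $\{0,1,\dots,d\}$ is admissible if $\Lambda_0=\{0\}$, each $\Lambda_i$ is nonempty, and for each $i$ the set $\Lambda_i^T=\{\alpha':\alpha\in\Lambda_i\}$ equals some $\Lambda_j$. Given such a partition, set $R_{\Lambda_i}=\bigcup_{\alpha\in\Lambda_i}R_\alpha$; if $(X,\{R_{\Lambda_i}\}_{i=0}^e)$ is an association scheme it is called a fusion scheme. The scheme is amorphous if every admissible partition of $\{0,\dots,d\}$ gives rise to a fusion scheme. *)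

(* Defs.v *)
From mathcomp Require Import all_boot.

Set Implicit Arguments.
Unset Strict Implicit.
Unset Printing Implicit Defensive.

Definition converse (X : finType) (S : {set X * X}) : {set X * X} :=
  [set p | (p.2, p.1) \in S].

(* Blocks of an indexed partition are pairwise distinct and nonempty, so that
   there are exactly as many blocks as indices. *)
Definition indexed_partition (I T : finType) (F : I -> {set T}) : Prop :=
  injective F /\ partition [set F i | i : I] [set: T].

Record association_scheme (X : finType) (d : nat)
    (R : 'I_d.+1 -> {set X * X}) : Prop := AssociationScheme {
  scheme_card : 1 < #|X|;
  scheme_partition : indexed_partition R;
  scheme_diagonal : R ord0 = [set p | p.1 == p.2];
  scheme_converse : forall i, exists i', converse (R i) = R i';
  scheme_intersection : forall i j k, exists p : nat,
    forall x y, (x, y) \in R k ->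
      #|[set z | ((x, z) \in R i) && ((z, y) \in R j)]| = p
}.

Definition symmetric_relation (X : finType) (S : {set X * X}) : Prop :=
  converse S = S.

Definition skew_symmetric (X : finType) (d : nat)
    (R : 'I_d.+1 -> {set X * X}) : Prop :=
  forall i, symmetric_relation (R i) <-> i = ord0.

(* The set of all alpha' for alpha in L, where alpha' is the index such that
   R alpha' is the converse of R alpha. *)
Definition index_converse (X : finType) (d : nat)
    (R : 'I_d.+1 -> {set X * X}) (L : {set 'I_d.+1}) : {set 'I_d.+1} :=
  [set b | [exists a in L, converse (R a) == R b]].

Definition admissible (X : finType) (d : nat) (R : 'I_d.+1 -> {set X * X})
    (e : nat) (L : 'I_e.+1 -> {set 'I_d.+1}) : Prop :=
  [/\ indexed_partition L, L ord0 = [set ord0]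
    & forall i, exists j, index_converse R (L i) = L j].

Definition fusion (X : finType) (d : nat) (R : 'I_d.+1 -> {set X * X})
    (e : nat) (L : 'I_e.+1 -> {set 'I_d.+1}) (i : 'I_e.+1) : {set X * X} :=
  \bigcup_(a in L i) R a.

Definition amorphous (X : finType) (d : nat)
    (R : 'I_d.+1 -> {set X * X}) : Prop :=
  forall (e : nat) (L : 'I_e.+1 -> {set 'I_d.+1}),
    admissible R L -> association_scheme (fusion R L).

(* Main.v *)
(** Choose one nondiagonal relation A and let B contain one relation out of
each remaining converse pair. Put s = A - A^T, u = B - B^T, M = A + A^T (as
integer matrices), n = |X|, and let K, L be the row sums of M and B + B^T.
The fusions {A+B, A^T+B^T} and {A+B^T, A^T+B} are doubly regular tournaments,
so n = 3 mod 4 and (s+u)^2 = (s-u)^2 = J - nI, whence s^2 + u^2 = J - nI.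
In the fusion {A, A^T, B+B^T} the matrix Ms is a combination of I, A, A^T and
B+B^T; its diagonal, its row sums and the trace of MsM vanish, which leaves
Ms = th s with th an integer. Likewise Mu = ta u. Multiplying
s^2 + u^2 = J - nI by M and by M^2 and reading off the diagonal gives
- th K - ta L = K and - th^2 K - ta^2 L = K^2 - nK, and with n = 1 + K + L
these force n = (th - ta)^2, which is not 3 mod 4. *)

Require Import Defs.
From mathcomp Require Import all_boot all_order all_algebra.
From mathcomp Require Import zify ring.

Set Implicit Arguments.
Unset Strict Implicit.
Unset Printing Implicit Defensive.

Import Order.TTheory GRing.Theory Num.Theory.

Local Open Scope ring_scope.

(** * Integer matrices on [X] and their products *)

Definition conv (X : finType) (f g : X -> X -> int) (x y : X) : int :=
  \sum_z f x z * g z y.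

Definition skew (X : finType) (w : X -> X -> int) : Prop :=
  forall x y, w y x = - w x y.

Definition signed (T : Type) (w : T -> int) : Prop :=
  forall t, [\/ w t = 0, w t = 1 | w t = -1].

(* The functions of the pair (w, diagonal) are closed under matrix product: they
   form the adjacency algebra of the fusion by the sign of [w]. *)
Definition conv_closed (X : finType) (w : X -> X -> int) : Prop :=
  forall F G : int -> bool -> int, exists H : int -> bool -> int, forall x y,
    conv (fun x z => F (w x z) (x == z)) (fun z y => G (w z y) (z == y)) x y
    = H (w x y) (x == y).

Lemma eq_conv (X : finType) (f f' g g' : X -> X -> int) x y :
  (forall x y, f x y = f' x y) -> (forall x y, g x y = g' x y) ->
  conv f g x y = conv f' g' x y.
Proof. by move=> ef eg; apply: eq_bigr => z _; rewrite ef eg. Qed.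

Lemma convA (X : finType) (f g h : X -> X -> int) x y :
  conv f (conv g h) x y = conv (conv f g) h x y.
Proof.
rewrite /conv; under eq_bigr do rewrite big_distrr /=.
rewrite exchange_big /=; apply: eq_bigr => z _.
by rewrite big_distrl /=; apply: eq_bigr => t _; rewrite mulrA.
Qed.

Lemma conv_eigen (X : finType) (m s t : X -> X -> int) (a : int) x y :
  (forall x y, conv m s x y = a * s x y) ->
  conv m (conv s t) x y = a * conv s t x y.
Proof.
move=> mE; rewrite convA /conv big_distrr /=; apply: eq_bigr => z _.
by rewrite -/(conv m s x z) mE mulrA.
Qed.

Lemma sum_delta (X : finType) (f : X -> int) x :
  \sum_z (x == z)%:R * f z = f x.
Proof.
rewrite (bigD1 x) //= eqxx mul1r big1 ?addr0 // => z.
by rewrite eq_sym => /negPf->; rewrite mul0r.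
Qed.

Lemma sum_delta1 (X : finType) (x : X) : \sum_z (x == z)%:R = 1 :> int.
Proof.
by under eq_bigr do rewrite -[_%:R]mulr1; rewrite (sum_delta (fun=> 1)).
Qed.

Lemma sum_conv (X : finType) (f g : X -> X -> int) x :
  (forall z, \sum_y g z y = 0) -> \sum_y conv f g x y = 0.
Proof.
move=> g0; rewrite /conv exchange_big /= big1 // => z _.
by rewrite -big_distrr /= g0 mulr0.
Qed.

(** * Signed and skew matrices, and their row sums *)

Lemma signed_cube (T : Type) (w : T -> int) t :
  signed w -> w t * w t * w t = w t.
Proof. by move=> /(_ t) []->. Qed.

Lemma skew_diag (X : finType) (w : X -> X -> int) x : skew w -> w x x = 0.
Proof. by move=> /(_ x x); lia. Qed.

(** The all-ones matrix [J] is a function of the pair too; the product with it has the row sums on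
    its diagonal, where the pair is always [(0, true)]. *)
Lemma conv_closed_row (X : finType) (w : X -> X -> int)
    (F : int -> bool -> int) :
  skew w -> conv_closed w ->
  exists k, forall x, \sum_y F (w x y) (x == y) = k.
Proof.
move=> sk /(_ F (fun _ _ => 1)) [H HE]; exists (H 0 true) => x.
move: (HE x x); rewrite (skew_diag x sk) eqxx => <-.
by apply: eq_bigr => z _; rewrite mulr1.
Qed.

Lemma skew_sum2 (X : finType) (w : X -> X -> int) :
  skew w -> \sum_x \sum_y w x y = 0.
Proof.
move=> sk; set S := \sum_x _.
suff: S = - S by lia.
rewrite {1}/S exchange_big -sumrN; apply: eq_bigr => x _.
by rewrite -sumrN; apply: eq_bigr => y _; rewrite sk.
Qed.

(** All row sums equal one constant [k], and skewness makes the total [#|X| * k] vanish. *)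
Lemma conv_closed_row0 (X : finType) (w : X -> X -> int) x :
  skew w -> conv_closed w -> \sum_y w x y = 0.
Proof.
move=> sk cl; have [k kE] := conv_closed_row (fun v _ => v) sk cl.
have := skew_sum2 sk; under eq_bigr do rewrite kE.
rewrite kE sumr_const => /eqP; rewrite mulrn_eq0 => /orP[/eqP c0|/eqP //].
by move: (card0_eq c0 x); rewrite inE.
Qed.

Lemma skew_col0 (X : finType) (w : X -> X -> int) y :
  skew w -> (forall x, \sum_y w x y = 0) -> \sum_x w x y = 0.
Proof.
move=> sk r0; under eq_bigr do rewrite sk.
by rewrite sumrN r0 oppr0.
Qed.

(** * Doubly regular tournaments *)

Lemma sum_offdiag (X : finType) (x : X) :
  \sum_y (1 - (x == y)%:R) = #|X|%:R - 1 :> int.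
Proof.
by rewrite sumrB sumr_const sum_delta1.
Qed.

Lemma conv_skew_sym (X : finType) (w : X -> X -> int) x y :
  skew w -> conv w w y x = conv w w x y.
Proof.
move=> sk; apply: eq_bigr => z _.
by rewrite (sk z y) (sk x z) mulrNN mulrC.
Qed.

Lemma offdiag_sign (X : finType) (w : X -> X -> int) :
  (forall x y, w x y * w x y = 1 - (x == y)%:R) ->
  forall x y, x != y -> w x y = 1 \/ w x y = -1.
Proof.
move=> w2 x y /negPf nxy; move: (w2 x y); rewrite nxy subr0 => /eqP.
by rewrite -expr2 sqrf_eq1 => /orP[]/eqP; [left|right].
Qed.

Lemma sum_sqr_gt0 (T : finType) (f : T -> int) t :
  f t != 0 -> 0 < \sum_i f i * f i.
Proof.
move=> ft; rewrite (bigD1 t) //= ltr_wpDr //.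
  by apply: sumr_ge0 => i _; rewrite -expr2 sqr_ge0.
by rewrite -expr2 exprn_even_gt0.
Qed.

(** The square of a skew matrix is symmetric, so closure leaves a single off-diagonal value
    [h = H 1 false]. Vanishing row sums of [w^2] then give [(n - 1) * (h - 1) = 0] with
    [n = #|X|]. *)
Lemma tournament_conv (X : finType) (w : X -> X -> int) x y :
  skew w -> (forall x y, w x y * w x y = 1 - (x == y)%:R) ->
  conv_closed w -> conv w w x y = 1 - #|X|%:R * (x == y)%:R.
Proof.
move=> sk w2 cl.
have r0 z := conv_closed_row0 z sk cl.
have wxx z : conv w w z z = 1 - #|X|%:R.
  rewrite -[RHS]opprB -(sum_offdiag z) -sumrN; apply: eq_bigr => t _.
  by rewrite (sk z t) mulrN w2.
have [->|nxy] := eqVneq x y; first by rewrite wxx mulr1.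
have [H HE0] := cl (fun v _ => v) (fun v _ => v).
have HE z t : conv w w z t = H (w z t) (z == t) by rewrite -HE0.
have wv := offdiag_sign w2.
have nyx : y != x by rewrite eq_sym.
have HN : H (-1) false = H 1 false.
  have := HE x y; have := HE y x; rewrite conv_skew_sym // (sk x y).
  rewrite (negPf nxy) (negPf nyx).
  by case: (wv _ _ nxy) => ->; rewrite ?opprK => -> ->.
have HE' z t :
    conv w w z t = (1 - #|X|%:R) * (z == t)%:R + H 1 false * (1 - (z == t)%:R).
  have [->|nzt] := eqVneq z t; first by rewrite wxx subrr mulr0 addr0 mulr1.
  rewrite HE (negPf nzt) mulr0 add0r subr0 mulr1.
  by case: (wv _ _ nzt) => ->.
have := sum_conv w x r0; under eq_bigr do rewrite HE'.
rewrite big_split /= -!big_distrr /= sum_offdiag sum_delta1.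
have X2 : (1 < #|X|)%N by apply/card_gt1P; exists x, y.
have e : (1 - #|X|%:R) * 1 + H 1 false * (#|X|%:R - 1) =
         (#|X|%:R - 1) * (H 1 false - 1) :> int by ring.
rewrite e => /eqP; rewrite mulf_eq0 => /orP[] /eqP E0; first by lia.
by rewrite HE' (negPf nxy) (subr0_eq E0) !mulr0 !subr0 mulr1 add0r.
Qed.

(** Counts paths of length two in the tournament [w = 1] with adjacency matrix [T]: from
    [2T = J - I + w], [wJ = Jw = 0] and [w^2 = J - nI] comes [4T^2 = n - 1 - 2w] off the
    diagonal. *)
Lemma tournament_card (X : finType) (w : X -> X -> int) (x y : X) :
  skew w -> (forall x y, w x y * w x y = 1 - (x == y)%:R) ->
  conv_closed w -> x != y -> exists t : int, #|X|%:R = 4 * t + 3.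
Proof.
move=> sk w2 cl nxy.
have r0 z := conv_closed_row0 z sk cl.
have wv := offdiag_sign w2.
pose T z t : int := (w z t == 1)%:R.
have TE z t : 2 * T z t = 1 - (z == t)%:R + w z t.
  rewrite /T; have [->|nzt] := eqVneq z t; first by rewrite (skew_diag _ sk).
  by case: (wv _ _ nzt) => ->.
have E : 4 * conv T T x y = #|X|%:R - 1 - 2 * w x y.
  rewrite /conv big_distrr /=.
  have -> : \sum_z 4 * (T x z * T z y) =
     \sum_z ((1 - (y == z)%:R) + (- ((x == z)%:R * (1 - (z == y)%:R + w z y)) +
     (w x z + (- ((y == z)%:R * w x z) + (w z y + w x z * w z y))))).
    apply: eq_bigr => z _.
    have -> : 4 * (T x z * T z y) = (2 * T x z) * (2 * T z y) by ring.
    by rewrite !TE (eq_sym z y); ring.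
  rewrite !big_split /= !sumrN !sum_delta sum_delta1 sumr_const r0 skew_col0 //.
  have := tournament_conv x y sk w2 cl; rewrite /conv => ->.
  by rewrite (negPf nxy) /=; ring.
(* Both signs give the residue 3, since 2 and -2 agree modulo 4. *)
case: (wv _ _ nxy) => wE; rewrite wE in E.
  by exists (conv T T x y); lia.
by exists (conv T T x y - 1); lia.
Qed.

(** * The eigenvalue relation [M s = th s] *)

(** Each inner sum is a diagonal entry of the skew matrix [m s m], so it already vanishes. *)
Lemma trace_sym_skew (X : finType) (m s : X -> X -> int) :
  skew s -> (forall x y, m y x = m x y) ->
  \sum_x \sum_y conv m s x y * m x y = 0.
Proof.
move=> sk my; apply: big1 => x _; set S := \sum_y _.
suff: S = - S by lia.
rewrite {1}/S /conv; under eq_bigr do rewrite big_distrl /=.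
rewrite exchange_big /= -sumrN; apply: eq_bigr => y _.
rewrite big_distrl /= -sumrN.
by apply: eq_bigr => z _; rewrite (sk z y); ring.
Qed.

(** Closure leaves three off-diagonal values [b], [c], [e] for [M s]. The trace against [M] removes
    [b + c] and the row sums remove [e]; the points given make the totals to be cancelled
    positive. *)
Lemma conv_closed_eigen (X : finType) (s : X -> X -> int)
    (x0 y0 x1 y1 : X) :
  skew s -> (forall x, signed (s x)) -> conv_closed s ->
  s x0 y0 != 0 -> x1 != y1 -> s x1 y1 = 0 ->
  exists th, forall x y,
    conv (fun x y => s x y * s x y) s x y = th * s x y.
Proof.
move=> sk sg cl s0 n1 s1.
have r0 z := conv_closed_row0 z sk cl.
pose m x y := s x y * s x y; rewrite -/m.
have ms x y : m x y * s x y = s x y by rewrite /m signed_cube.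
have my x y : m y x = m x y by rewrite /m sk mulrNN.
have mxx x : m x x = 0 by rewrite /m (skew_diag _ sk).
have m_le1 x y : m x y <= 1 by rewrite /m; case: (sg x y) => ->.
have [H HE0] := cl (fun v _ => v * v) (fun v _ => v).
have HE x y : conv m s x y = H (s x y) (x == y) by rewrite -HE0.
have [K KE] := conv_closed_row (fun v _ => v * v) sk cl.
have {}KE x : \sum_y m x y = K by rewrite KE.
set b := H 1 false; set c := H (-1) false; set e := H 0 false.
(* Doubling avoids the halves of [b + c] and [b - c]. On the diagonal both sides vanish, because [s]
   has zero column sums. *)
have gE x y : 2 * conv m s x y =
    (b + c) * m x y + ((b - c) * s x y + 2 * e * (1 - (x == y)%:R - m x y)).
  have [<-|nxy] := eqVneq x y.
    rewrite mxx (skew_diag _ sk) /conv.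
    under eq_bigr => z _ do rewrite -my ms.
    by rewrite skew_col0 //=; ring.
  rewrite HE (negPf nxy) /m; case: (sg x y) => ->; rewrite -/b -/c -/e /=; ring.
(* Pairing with [m] restricts to the support of [s], away from the [e] term; zero row sums of [s]
   kill the [b - c] term. *)
have trE : (b + c) * (#|X|%:R * K) = 0.
  have : 2 * \sum_x \sum_y conv m s x y * m x y = 0.
    by rewrite trace_sym_skew.
  rewrite big_distrr /=.
  have E x : 2 * \sum_y conv m s x y * m x y = (b + c) * K.
    rewrite big_distrr /=.
    have -> : \sum_y 2 * (conv m s x y * m x y) =
      \sum_y ((b + c) * m x y + (b - c) * s x y).
      apply: eq_bigr => y _.
      have -> : 2 * (conv m s x y * m x y) = 2 * conv m s x y * m x y by ring.
      rewrite gE.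
      have [->|nxy] := eqVneq x y; first by rewrite mxx (skew_diag _ sk); ring.
      by rewrite /m; case: (sg x y) => -> /=; ring.
    by rewrite big_split /= -!big_distrr /= KE r0 mulr0 addr0.
  under eq_bigr do rewrite E.
  by rewrite sumr_const -mulr_natr => <-; ring.
have K_gt0 : 0 < K by rewrite -(KE x0); apply: sum_sqr_gt0 s0.
have X_gt0 : (0 < #|X|)%N by apply/card_gt0P; exists x0.
have bc0 : b + c = 0.
  move/eqP: trE; rewrite !mulf_eq0 (gt_eqF K_gt0) orbF => /orP[/eqP //|/eqP].
  by lia.
have e0 : e = 0.
  have rs : \sum_y 2 * conv m s x1 y = 0.
    by rewrite -big_distrr /= sum_conv // mulr0.
  have L_gt0 : 0 < \sum_y (1 - (x1 == y)%:R - m x1 y).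
    rewrite (bigD1 y1) //= ltr_wpDr //.
      apply: sumr_ge0 => y _; have [->|_] := eqVneq x1 y.
        by rewrite mxx.
      by rewrite subr0 subr_ge0.
    by rewrite /m s1 (negPf n1) mulr0 !subr0.
  move: rs; under eq_bigr do rewrite gE bc0 mul0r add0r.
  rewrite big_split /= -!big_distrr /= r0 mulr0 add0r => /eqP.
  by rewrite !mulf_eq0 (gt_eqF L_gt0) orbF => /orP[|/eqP].
exists b => x y; have := gE x y.
have -> : c = - b by lia.
by rewrite e0 => E; apply: (@mulfI _ 2) => //; rewrite E; ring.
Qed.

(** * Eigenvalue arithmetic and the contradiction in matrix form *)

Lemma square_mod4 (r t : int) : r * r = 4 * t + 3 -> False.
Proof.
move=> E; have := divz_eq r 2; have := modz_ge0 r (isT : 2 != 0 :> int).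
by have := ltz_pmod r (isT : 0 < 2 :> int); nia.
Qed.

(** Cancelling [K] gives [L = (1 + th) * (th - 1 - ta)], then cancelling [1 + th] gives
    [K = - ta * (th - 1 - ta)]; adding 1 to their sum completes the square. *)
Lemma eigen_square (K L n th ta : int) :
  0 < L -> 0 < K -> n = 1 + K + L ->
  - th * K - ta * L = K -> - (th * th) * K - ta * ta * L = K * K - n * K ->
  n = (th - ta) * (th - ta).
Proof.
move=> L0 K0 nE E1 E2.
have E3 : L = (1 + th) * (th - 1 - ta).
  apply: (mulIf (lt0r_neq0 K0)).
  have e1 : ta * L = - (1 + th) * K by lia.
  have e2 : ta * ta * L = - ta * (1 + th) * K by rewrite -mulrA e1; ring.
  by rewrite nE e2 in E2; lia.
have t0 : 1 + th != 0 by apply/eqP => t0; rewrite E3 t0 mul0r in L0.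
have E4 : K = - ta * (th - 1 - ta).
  apply: (mulIf t0).
  have -> : K * (1 + th) = - (ta * L) by lia.
  by rewrite E3; ring.
by rewrite nE E4 E3; ring.
Qed.

(** The contradiction freed from schemes: amorphousness enters only as closure for the fusions by
    the signs of [s], [u], [s + u] and [s - u]. *)
Lemma no_skew_pair (X : finType) (s u : X -> X -> int) (x0 y0 x1 y1 : X) :
  skew s -> skew u -> (forall x, signed (s x)) -> (forall x, signed (u x)) ->
  (forall x y, s x y * s x y + u x y * u x y = 1 - (x == y)%:R) ->
  conv_closed s -> conv_closed u ->
  conv_closed (fun x y => s x y + u x y) ->
  conv_closed (fun x y => s x y - u x y) ->
  s x0 y0 != 0 -> u x1 y1 != 0 -> False.
Proof.
move=> sks sku sgs sgu su1 cls clu clp clm s0 u0.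
(* The squares sum to at most 1, so the supports of [s] and [u] are disjoint. *)
have su0 x y : s x y * u x y = 0.
  move: (su1 x y); case: (sgs x y) => ->; case: (sgu x y) => ->;
    by case: (x == y).
have n0 : x0 != y0 by apply: contraNneq s0 => ->; rewrite (skew_diag _ sks).
have n1 : x1 != y1 by apply: contraNneq u0 => ->; rewrite (skew_diag _ sku).
have u00 : u x0 y0 = 0.
  by apply/eqP; move/eqP: (su0 x0 y0); rewrite mulf_eq0 (negPf s0).
have s11 : s x1 y1 = 0.
  by apply/eqP; move/eqP: (su0 x1 y1); rewrite mulf_eq0 (negPf u0) orbF.
have skp : skew (fun x y => s x y + u x y) by move=> x y; rewrite sks sku opprD.
have skm : skew (fun x y => s x y - u x y) by move=> x y; rewrite sks sku opprD.
have p2 x y : (s x y + u x y) * (s x y + u x y) = 1 - (x == y)%:R.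
  rewrite -su1 -[RHS]addr0 -[0 in RHS](mulr0 2) -(su0 x y); ring.
have m2 x y : (s x y - u x y) * (s x y - u x y) = 1 - (x == y)%:R.
  rewrite -su1 -[RHS]subr0 -[0 in RHS](mulr0 2) -(su0 x y); ring.
have [t nE] := tournament_card skp p2 clp n0.
have cE x y : conv s s x y + conv u u x y = 1 - #|X|%:R * (x == y)%:R.
  apply: (@mulfI _ 2) => //.
  have P := tournament_conv x y skp p2 clp.
  have M := tournament_conv x y skm m2 clm.
  transitivity (conv (fun x y => s x y + u x y) (fun x y => s x y + u x y) x y +
      conv (fun x y => s x y - u x y) (fun x y => s x y - u x y) x y).
    rewrite /conv -!big_split big_distrr /=.
    by apply: eq_bigr => z _; ring.
  by rewrite P M; ring.
have [th thE] := conv_closed_eigen sks sgs cls s0 n1 s11.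
have [ta' taE'] := conv_closed_eigen sku sgu clu u0 n0 u00.
(* The entrywise square of [u] is [J - I - m] and [J u = 0], so its eigenvalue [ta'] becomes
   [-1 - ta'] for [m]. *)
pose m x y := s x y * s x y; pose ta := - 1 - ta'.
have {}thE x y : conv m s x y = th * s x y by exact: thE.
have my x y : m y x = m x y by rewrite /m sks mulrNN.
have taE x y : conv m u x y = ta * u x y.
  have -> : conv m u x y =
      \sum_z (u z y - (x == z)%:R * u z y - u x z * u x z * u z y).
    by apply: eq_bigr => z _; rewrite -[m x z](addrK (u x z * u x z)) su1; ring.
  rewrite !sumrB sum_delta skew_col0 //; last first.
    by move=> z; apply: conv_closed_row0.
  by have := taE' x y; rewrite /conv /ta => ->; ring.
have [K KE] := conv_closed_row (fun v _ => v * v) sks cls.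
have [L LE] := conv_closed_row (fun v _ => v * v) sku clu.
have K_gt0 : 0 < K by rewrite -(KE x0); apply: sum_sqr_gt0 s0.
have L_gt0 : 0 < L by rewrite -(LE x1); apply: sum_sqr_gt0 u0.
have KL : #|X|%:R = 1 + K + L.
  have := sum_offdiag x0; under eq_bigr do rewrite -su1.
  by rewrite big_split /= KE LE; lia.
have ssd x : conv s s x x = - K.
  rewrite -(KE x) -sumrN; apply: eq_bigr => z _.
  by rewrite (sks x z) mulrN.
have uud x : conv u u x x = - L.
  rewrite -(LE x) -sumrN; apply: eq_bigr => z _.
  by rewrite (sku x z) mulrN.
have mcE x y : th * conv s s x y + ta * conv u u x y = K - #|X|%:R * m x y.
  rewrite -(conv_eigen _ _ _ thE) -(conv_eigen _ _ _ taE) /conv -big_split /=.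
  have -> : K - #|X|%:R * m x y =
      \sum_z (m x z - #|X|%:R * ((y == z)%:R * m x z)).
    by rewrite sumrB -big_distrr /= sum_delta KE.
  apply: eq_bigr => z _; have := cE z y; rewrite /conv => cEzy.
  by rewrite -mulrDr cEzy (eq_sym y z); ring.
have E1 : - th * K - ta * L = K.
  have := mcE x0 x0; rewrite ssd uud /m (skew_diag _ sks) !mulr0 subr0.
  by move=> {2}<-; ring.
(* A second product with [m], read at [(x0, x0)]; the entries of [m] are 0 and 1, so [m^2] has
   diagonal [K]. *)
have E2 : - (th * th) * K - ta * ta * L = K * K - #|X|%:R * K.
  have <- : th * (th * conv s s x0 x0) + ta * (ta * conv u u x0 x0) =
      - (th * th) * K - ta * ta * L by rewrite ssd uud; ring.
  rewrite -(conv_eigen _ _ _ thE) -(conv_eigen _ _ _ taE).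
  rewrite {1 3}/conv !big_distrr -big_split /=.
  have -> : K * K - #|X|%:R * K =
      \sum_z (K * m x0 z - #|X|%:R * (m x0 z * m x0 z)).
    rewrite sumrB -!big_distrr /= KE; congr (_ - _ * _).
    rewrite -(KE x0); apply: eq_bigr => z _.
    by rewrite /m mulrA (signed_cube _ (sgs x0)).
  apply: eq_bigr => z _.
  have -> : K * m x0 z - #|X|%:R * (m x0 z * m x0 z) =
     m x0 z * (K - #|X|%:R * m z x0) by rewrite (my x0 z); ring.
  by rewrite -mcE; ring.
have := eigen_square L_gt0 K_gt0 KL E1 E2.
by rewrite nE => /esym; apply: square_mod4.
Qed.

(** * Schemes as colourings of pairs *)

(** Covering puts each point in a block, disjointness and injectivity of [F] make the index unique,
    and finite choice yields a function. *)
Lemma indexed_partition_colour (I T : finType) (F : I -> {set T}) :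
  Defs.indexed_partition F -> exists col : T -> I, forall t i,
    (t \in F i) = (col t == i).
Proof.
move=> [injF /and3P[/eqP covF /trivIsetP trivF _]].
have ex t : exists i, t \in F i.
  have : t \in cover [set F i | i : I] by rewrite covF inE.
  by case/bigcupP => _ /imsetP[i _ ->] ti; exists i.
have [col colE] := fin_all_exists ex; exists col => t i.
apply/idP/eqP => [ti|<- //]; apply: injF; apply/eqP/negPn/negP => neq.
have := trivF _ _ (imset_f F isT) (imset_f F isT) neq.
by rewrite -setI_eq0 => /eqP/setP/(_ t); rewrite !inE colE ti.
Qed.

Lemma fibres_indexed_partition (I T : finType) (c : T -> I) :
  (forall i, exists t, c t = i) ->
  Defs.indexed_partition (fun i => [set t | c t == i]).
Proof.
move=> surj; split.
  move=> i j; have [t ti] := surj i => /setP/(_ t).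
  by rewrite !inE ti eqxx => /esym/eqP.
apply/and3P; split.
- apply/eqP/setP => t; rewrite inE; apply/bigcupP.
  by exists [set t' | c t' == c t]; rewrite ?imset_f ?inE.
- apply/trivIsetP => _ _ /imsetP[i _ ->] /imsetP[j _ ->] neq.
  rewrite -setI_eq0; apply: contraNT neq => /set0Pn[t].
  by rewrite !inE => /andP[/eqP-> /eqP->].
- apply/imsetP => -[i _] /setP; have [t ti] := surj i.
  by move=> /(_ t); rewrite !inE ti eqxx.
Qed.

(** Replaces existential clauses of a scheme by functions: [col] colours the pairs, and [cv] is the
    map from [i] to [i']. *)
Record scheme_indexing (X : finType) (d : nat) (R : 'I_d.+1 -> {set X * X})
    (col : X * X -> 'I_d.+1) (cv : 'I_d.+1 -> 'I_d.+1) : Prop := {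
  indexing_inj : injective R;
  indexingE : forall p i, (p \in R i) = (col p == i);
  indexing_converse : forall i, converse (R i) = R (cv i);
  indexing_diag : forall x y, (col (x, y) == ord0) = (x == y)
}.

Lemma association_scheme_indexing (X : finType) (d : nat)
    (R : 'I_d.+1 -> {set X * X}) :
  association_scheme R -> exists col cv, scheme_indexing R col cv.
Proof.
case=> _ partR diagR cvR _.
have [col colE] := indexed_partition_colour partR.
have [cv cvE] := fin_all_exists cvR.
exists col, cv; split=> //; first by case: partR.
by move=> x y; rewrite -colE diagR inE.
Qed.

Lemma indexing_involutive (X : finType) (d : nat) (R : 'I_d.+1 -> {set X * X})
    col cv : scheme_indexing R col cv -> involutive cv.
Proof.
case=> injR _ cvE _ i; apply: injR; rewrite -!cvE.
by apply/setP => -[x y]; rewrite !inE.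
Qed.

Lemma indexing_swap (X : finType) (d : nat) (R : 'I_d.+1 -> {set X * X})
    col cv x y : scheme_indexing R col cv -> col (y, x) = cv (col (x, y)).
Proof.
case=> _ colE cvE _; apply/eqP; rewrite -colE -cvE inE /=.
by rewrite colE.
Qed.

Lemma indexing_cv0 (X : finType) (d : nat) (R : 'I_d.+1 -> {set X * X})
    col cv : association_scheme R -> scheme_indexing R col cv -> cv ord0 = ord0.
Proof.
move=> asR [injR _ cvE _]; apply: injR; rewrite -cvE (scheme_diagonal asR).
by apply/setP => -[x y]; rewrite !inE /= eq_sym.
Qed.

Lemma indexing_surj (X : finType) (d : nat) (R : 'I_d.+1 -> {set X * X})
    col cv i : association_scheme R -> scheme_indexing R col cv ->
  exists x y, col (x, y) = i.
Proof.
move=> asR [_ colE _ _]; have [_ /and3P[_ _ n0]] := scheme_partition asR.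
have : R i != set0 by apply: contraNneq n0 => <-; rewrite imset_f.
by case/set0Pn => -[x y]; rewrite colE => /eqP; exists x, y.
Qed.

(** * From fusions to closed matrices *)

(** The fibres of [c] form an admissible partition, with converse map [cv']. Grouping the middle
    points [z] by the blocks of [(x, z)] and [(z, y)] expresses the product through intersection
    numbers of the fusion. *)
Lemma fusion_conv (X : finType) (d e : nat) (R : 'I_d.+1 -> {set X * X})
    (col : X * X -> 'I_d.+1) (cv : 'I_d.+1 -> 'I_d.+1)
    (c : 'I_d.+1 -> 'I_e.+1) (cv' : 'I_e.+1 -> 'I_e.+1) :
  amorphous R -> scheme_indexing R col cv ->
  (forall k, exists a, c a = k) -> (forall a, (c a == ord0) = (a == ord0)) ->
  (forall a, c (cv a) = cv' (c a)) ->
  forall F G : 'I_e.+1 -> int, exists H : 'I_e.+1 -> int, forall x y,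
    conv (fun x z => F (c (col (x, z)))) (fun z y => G (c (col (z, y)))) x y
    = H (c (col (x, y))).
Proof.
move=> amR ix surj c0 ccv F G.
have cvK := indexing_involutive ix; have [injR colE cvE _] := ix.
pose L k := [set a | c a == k].
have cvK' : involutive cv'.
  by move=> k; have [a <-] := surj k; rewrite -!ccv cvK.
have admL : admissible R L.
  split; first exact: fibres_indexed_partition.
    by apply/setP => a; rewrite !inE c0.
  move=> k; exists (cv' k); apply/setP => b; rewrite !inE.
  apply/existsP/eqP => [[a]|cb].
    by rewrite inE cvE => /andP[/eqP <- /eqP/injR <-].
  by exists (cv b); rewrite inE ccv cb cvK' cvE cvK !eqxx.
have [_ _ _ _ inter] := amR e L admL.
have fusE p k : (p \in fusion R L k) = (c (col p) == k).
  apply/bigcupP/eqP => [[a]|<-]; first by rewrite inE colE => /eqP<- /eqP->.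
  by exists (col p); rewrite ?inE ?colE.
have interE (t : 'I_e.+1 * 'I_e.+1 * 'I_e.+1) : exists p : nat, forall x y,
    c (col (x, y)) = t.2 -> #|[set z | (c (col (x, z)) == t.1.1) &&
                                      (c (col (z, y)) == t.1.2)]| = p.
  have [p pE] := inter t.1.1 t.1.2 t.2; exists p => x y /eqP xyk.
  rewrite -(pE x y); last by rewrite fusE.
  by apply: eq_card => z; rewrite !inE !fusE.
have [p pE] := fin_all_exists interE.
exists (fun k => \sum_i \sum_j (p (i, j, k))%:R * (F i * G j)) => x y.
transitivity (\sum_i \sum_j \sum_(z | (c (col (x, z)) == i) &&
                                      (c (col (z, y)) == j)) F i * G j).
  rewrite /conv (partition_big (fun z => c (col (x, z))) predT) //=.
  apply: eq_bigr => i _.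
  rewrite (partition_big (fun z => c (col (z, y))) predT) //=.
  by apply: eq_bigr => j _; apply: eq_bigr => z /andP[/eqP-> /eqP->].
apply: eq_bigr => i _; apply: eq_bigr => j _.
rewrite sumr_const mulr_natl -(pE (i, j, c (col (x, y))) x y) //.
by congr (_ *+ _); apply: eq_card => z; rewrite inE.
Qed.

(* The colour classes of the fusion are the diagonal, [w = 1], [w = -1] and,
   when [e = 3], the nonzero indices where [w] vanishes. *)
Lemma fusion_sign_conv_closed (X : finType) (d e : nat)
    (R : 'I_d.+1 -> {set X * X}) col cv (w : 'I_d.+1 -> int) :
  association_scheme R -> amorphous R -> scheme_indexing R col cv ->
  signed w -> (forall a, w (cv a) = - w a) -> (exists a, w a != 0) ->
  (e = 2 /\ (forall a, w a = 0 -> a = ord0) \/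
   e = 3 /\ exists2 a, a != ord0 & w a = 0) ->
  conv_closed (fun x y => w (col (x, y))).
Proof.
move=> asR amR ix sg wN [a1 wa1] eP F G.
have cvK := indexing_involutive ix; have cv0 := indexing_cv0 asR ix.
have w0 : w ord0 = 0 by have := wN ord0; rewrite cv0; lia.
pose code a := if a == ord0 then 0%N else if w a == 1 then 1%N
               else if w a == -1 then 2%N else 3%N.
have code_lt a : (code a < e.+1)%N.
  rewrite /code; case: (eqVneq a ord0) => // na0.
  case: eqP => [|w1]; first by lia.
  case: eqP => [|wm1]; first by lia.
  case: eP => [[-> wz]|[-> //]].
  by case: (sg a) => // /wz /eqP; rewrite (negPf na0).
pose c a : 'I_e.+1 := inord (code a).
have cE a : c a = code a :> nat by rewrite inordK.
pose dv (k : 'I_e.+1) : int :=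
  if k == 1%N :> nat then 1 else if k == 2%N :> nat then -1 else 0.
have dvE a : dv (c a) = w a.
  rewrite /dv cE /code; case: (eqVneq a ord0) => [->|na0]; first by rewrite w0.
  by case: (sg a) => ->.
have dbE a : (c a == ord0) = (a == ord0).
  rewrite -val_eqE /= cE /code; case: (eqVneq a ord0) => // na0.
  by case: (w a == 1); case: (w a == -1).
(* Converses negate [w], so they swap blocks 1 and 2. *)
pose cv' (k : 'I_e.+1) : 'I_e.+1 :=
  inord (if k == 1%N :> nat then 2%N else if k == 2%N :> nat then 1%N else k).
have cv_eq0 a : (cv a == ord0) = (a == ord0).
  by rewrite -{1}cv0 (inj_eq (inv_inj cvK)).
have ccv a : c (cv a) = cv' (c a).
  rewrite /cv' cE; congr inord; rewrite /code cv_eq0 wN.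
  by case: (eqVneq a ord0) => // _; case: (sg a) => ->.
have surj k : exists a, c a = k.
  have : [\/ k = 0%N :> nat, k = 1%N :> nat, k = 2%N :> nat | k = 3%N :> nat].
    have : (k < 4)%N by have := ltn_ord k; case: eP => [[? _]|[? _]]; lia.
    case: (nat_of_ord k) => [|[|[|[|]]]] // _;
      by [constructor 1|constructor 2|constructor 3|constructor 4].
  have s1 a : w a = 1 -> c a = 1%N :> nat.
    move=> wa; rewrite cE /code wa eqxx; case: eqP => // a0.
    by rewrite a0 w0 in wa.
  have sN1 a : w a = -1 -> c a = 2%N :> nat.
    move=> wa; rewrite cE /code wa; case: eqP => // a0.
    by rewrite a0 w0 in wa.
  case=> kE.
  - by exists ord0; apply: val_inj; rewrite /= cE kE.
  - case: (sg a1) => wE; first by rewrite wE in wa1.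
      by exists a1; apply: val_inj; rewrite /= s1.
    by exists (cv a1); apply: val_inj; rewrite /= s1 // wN wE.
  - case: (sg a1) => wE; first by rewrite wE in wa1.
      by exists (cv a1); apply: val_inj; rewrite /= sN1 // wN wE.
    by exists a1; apply: val_inj; rewrite /= sN1.
  - have := ltn_ord k; rewrite kE; case: eP => [[e2 _]|[_ [a na0 wa]] _].
      by lia.
    by exists a; apply: val_inj; rewrite /= cE kE /code (negPf na0) wa.
have [H HE] := fusion_conv amR ix surj dbE ccv
  (fun k => F (dv k) (k == ord0)) (fun k => G (dv k) (k == ord0)).
(* For [e = 2] the index 3 is out of range, but that branch is never met: [w] then has no zero off
   the diagonal. *)
exists (fun v b => if b then H ord0 else
  if v == 1 then H (inord 1) else if v == -1 then H (inord 2) else H (inord 3)).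
move=> x y.
transitivity (H (c (col (x, y)))).
  by rewrite -HE; apply: eq_conv => z t; rewrite dvE dbE (indexing_diag ix).
rewrite -(indexing_diag ix) /c /code; case: (eqVneq _ ord0) => _.
  by congr H; apply: val_inj; rewrite /= inordK.
by case: eqP => // _; case: eqP.
Qed.

(** The number of blocks depends on whether [w] vanishes at a nonzero index, since an empty block
    would not be admissible. *)
Lemma sign_conv_closed (X : finType) (d : nat)
    (R : 'I_d.+1 -> {set X * X}) col cv (w : 'I_d.+1 -> int) :
  association_scheme R -> amorphous R -> scheme_indexing R col cv ->
  signed w -> (forall a, w (cv a) = - w a) -> (exists a, w a != 0) ->
  conv_closed (fun x y => w (col (x, y))).
Proof.
move=> asR amR ix sg wN wn0.
case: (boolP [exists a, (a != ord0) && (w a == 0)]) => [/existsP|/existsPn] wz.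
  have {}wz : exists2 a, a != ord0 & w a = 0.
    by case: wz => a /andP[a0 /eqP]; exists a.
  by apply: (@fusion_sign_conv_closed X d 3 R col cv) => //; right.
apply: (@fusion_sign_conv_closed X d 2 R col cv) => //; left; split=> // a wa.
by apply/eqP; have := wz a; rewrite wa eqxx andbT negbK.
Qed.

Local Close Scope ring_scope.

(** * Choice of the two matrices in a skew-symmetric scheme *)

Theorem mainTheorem2 (X : finType) (d : nat) (R : 'I_d.+1 -> {set X * X}) :
  4 <= d ->
  ~ [/\ association_scheme R, skew_symmetric R & amorphous R].
Proof.
move=> d4 [asR skR amR].
have [col [cv ix]] := association_scheme_indexing asR.
have cvK := indexing_involutive ix; have cv0 := indexing_cv0 asR ix.
(* Skew-symmetry enters here: only the diagonal is its own converse. *)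
have cv_fix a : (cv a == a) = (a == ord0).
  apply/eqP/eqP => [cva|->//]; apply/skR.
  by rewrite /symmetric_relation (indexing_converse ix) cva.
have cv_eq a b : (cv a == b) = (a == cv b) by rewrite (can2_eq cvK cvK).
pose i0 : 'I_d.+1 := ord_max.
have i0n : i0 != ord0 by rewrite -val_eqE /=; lia.
pose S : {set 'I_d.+1} := [set ord0; i0; cv i0].
(* [ws] is the sign on the pair of [i0]; [wu] orients every other converse pair, with 1 at the
   smaller index. *)
pose ws a : int := if a == i0 then 1%R else if a == cv i0 then (-1)%R else 0%R.
pose wu a : int := if a \in S then 0%R else if a < cv a then 1%R else (-1)%R.
have ScvE a : (cv a \in S) = (a \in S).
  by rewrite !inE !cv_eq cv0 cvK orbAC.
have cvn : cv i0 != i0 by rewrite cv_fix.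
have wsN a : ws (cv a) = (- ws a)%R.
  rewrite /ws !cv_eq cvK.
  case: (eqVneq a i0) => [->|_]; first by rewrite eq_sym (negPf cvn).
  by case: eqP.
have wuN a : wu (cv a) = (- wu a)%R.
  rewrite /wu ScvE cvK; case: ifPn => // aS.
  have : cv a != a.
    by rewrite cv_fix; apply: contraNneq aS => ->; rewrite !inE eqxx.
  by rewrite -val_eqE /=; case: ltngtP.
(* [S] has at most three of the [d + 1 >= 5] indices, so a converse pair is left for [wu]. *)
have [b bS] : exists b, b \notin S.
  apply/existsP; rewrite -negb_forall; apply/negP => /forallP all_S.
  have : #|'I_d.+1| <= #|S| by apply: subset_leq_card; apply/subsetP => a _.
  rewrite card_ord => le.
  have : #|S| <= 3.
    rewrite /S; apply: leq_trans (leq_card_setU _ _) _.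
    by rewrite cards1 addn1 ltnS cards2; case: eqP.
  by lia.
have sgs : signed ws.
  move=> a; rewrite /ws; case: eqP => _; first by constructor 2.
  by case: eqP => _; [constructor 3|constructor 1].
have sgu : signed wu.
  move=> a; rewrite /wu; case: ifP => _; first by constructor 1.
  by case: ifP => _; [constructor 2|constructor 3].
have wu0 a : a \in S -> wu a = 0%R by rewrite /wu => ->.
have ws0 a : a \notin S -> ws a = 0%R.
  by rewrite /ws !inE !negb_or => /andP[/andP[_ /negPf->] /negPf->].
have wsu_sg : signed (fun a => ws a + wu a)%R.
  move=> a; case: (boolP (a \in S)) => aS.
    by rewrite wu0 // addr0; apply: sgs.
  by rewrite ws0 // add0r; apply: sgu.
have wsu_sg' : signed (fun a => ws a - wu a)%R.
  move=> a; case: (boolP (a \in S)) => aS.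
    by rewrite wu0 // subr0; apply: sgs.
  by rewrite ws0 // sub0r -wuN; apply: sgu.
have i0S : i0 \in S by rewrite !inE eqxx orbT.
have ws1 : ws i0 = 1%R by rewrite /ws eqxx.
(* To be used four times: [ws] and [wu] give fusions with three nondiagonal classes, [ws + wu] and
   [ws - wu] the two tournaments. *)
have closed w := @sign_conv_closed X d R col cv w asR amR ix.
have [x0 [y0 xy0]] := indexing_surj i0 asR ix.
have [x1 [y1 xy1]] := indexing_surj b asR ix.
apply: (@no_skew_pair X (fun x y => ws (col (x, y)))
  (fun x y => wu (col (x, y))) x0 y0 x1 y1).
- by move=> x y; rewrite (indexing_swap x y ix) wsN.
- by move=> x y; rewrite (indexing_swap x y ix) wuN.
- by move=> x y; apply: sgs.
- by move=> x y; apply: sgu.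
- move=> x y; rewrite -(indexing_diag ix); move: (col (x, y)) => a.
  case: (boolP (a \in S)) => aS.
    rewrite wu0 //; move: aS; rewrite !inE /ws.
    case: (eqVneq a ord0) => [->|_] /=.
      by rewrite ![ord0 == _]eq_sym cv_eq cv0 (negPf i0n).
    by case: eqVneq => //= _ /eqP->; rewrite eqxx.
  rewrite ws0 // (_ : (a == ord0) = false); last first.
    by apply: contraNF aS => /eqP->; rewrite !inE eqxx.
  by rewrite /wu (negPf aS); case: ifP.
- by apply: closed => //; exists i0; rewrite ws1.
- by apply: closed => //; exists b; rewrite /wu (negPf bS); case: ifP.
- apply: (closed (fun a => ws a + wu a)%R) => // [a|].
    by rewrite wsN wuN opprD.
  by exists i0; rewrite ws1 wu0.
- apply: (closed (fun a => ws a - wu a)%R) => // [a|].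
    by rewrite wsN wuN opprD.
  by exists i0; rewrite ws1 wu0.
- by rewrite xy0 ws1.
- by rewrite xy1 /wu (negPf bS); case: ifP.
Qed.
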